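(* Let $p(w)=(w-w_1)(w-w_2)(w-w_3)$ with $w_1,w_2,w_3\in\mathbb{C}$ and $\operatorname{Re}w_1<\operatorname{Re}w_2<\operatorname{Re}w_3$. Let $z_1$ and $z_2$ be the critical points of $p$ (the two zeros of $p'$, counted with multiplicity), where either $z_1=z_2$, or $\operatorname{Re}z_1<\operatorname{Re}z_2$ if $z_1\neq z_2$. Let $\sigma_1=\dfrac{z_1-w_1}{w_2-w_1}$ and $\sigma_2=\dfrac{z_2-w_2}{w_3-w_2}$. Then $\sigma_1=\sigma_2$ if and only if $w_1,w_2,w_3$ are the vertices of an equilateral triangle which contains no vertical line segment (that is, none of whose sides is vertical).
   Context: The pair $(\sigma_1,\sigma_2)$ is the (complex) ratio vector of the cubic $p$. It is defined only when the three roots have pairwise distinct real parts and the two critical points either coincide or have distinct real parts; the roots and critical points are indexed by increasing real part. *)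

(* Defs.v *)
From HB Require Import structures.
From mathcomp Require Import all_boot all_order all_algebra.
From mathcomp Require Import complex.
From mathcomp Require Import reals.

Set Implicit Arguments.
Unset Strict Implicit.
Unset Printing Implicit Defensive.

Import Order.TTheory GRing.Theory Num.Theory.

Local Open Scope ring_scope.
Local Open Scope complex_scope.

Definition cubic (R : realType) (w1 w2 w3 : R[i]) : {poly R[i]} :=
  ('X - w1%:P) * ('X - w2%:P) * ('X - w3%:P).

(* The list [s] is the multiset of zeros of the nonzero polynomial [q]; the
   order of [s] is irrelevant. *)
Definition zeros_with_mult (R : realType) (q : {poly R[i]}) (s : seq R[i]) :
    Prop :=
  q != 0 /\ forall z : R[i], mup z q = count_mem z s.

(* With equal sides, [a != b] excludes exactly the degenerate case a = b = c. *)
Definition equilateral_triangle (R : realType) (a b c : R[i]) : Prop :=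
  [/\ a != b, `|b - a| = `|c - b| & `|c - b| = `|a - c|].

Definition vertical_segment (R : realType) (a b : R[i]) : Prop :=
  a != b /\ complex.Re a = complex.Re b.

Definition has_vertical_side (R : realType) (a b c : R[i]) : Prop :=
  [\/ vertical_segment a b, vertical_segment b c | vertical_segment c a].

(* Main.v *)
(** With a = w2 - w1 and b = w3 - w2, Vieta's formulas for x = z1 - w2 and
    y = z2 - w2 read 3(x + y) = 2(b - a) and 3xy = -ab, and the ratios are
    sigma1 = 1 + x/a and sigma2 = y/b.  Both sides of the equivalence amount to
    a^2 + ab + b^2 = 0: a common ratio s satisfies 3s^2 - 3s + 1 = 0, and
    u = 3s - 1 is then a primitive sixth root of unity with b = a u^2; conversely
    9(x - y)^2 = 4(a^2 + ab + b^2), so the two critical points coincide. *)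

Require Import Defs.
From HB Require Import structures.
From mathcomp Require Import all_boot all_order all_algebra.
From mathcomp Require Import complex.
From mathcomp Require Import reals.
From mathcomp Require Import ring.

Set Implicit Arguments.
Unset Strict Implicit.
Unset Printing Implicit Defensive.

Import Order.TTheory GRing.Theory Num.Theory.

Local Open Scope ring_scope.
Local Open Scope complex_scope.

Lemma mup_prod_XsubC (F : fieldType) (z : F) (s : seq F) :
  mup z (\prod_(x <- s) ('X - x%:P)) = count_mem z s.
Proof.
elim: s => [|x s IHs]; first by rewrite big_nil mupNroot ?root1.
rewrite big_cons mupM ?polyXsubC_eq0 ?monic_neq0 ?monic_prod_XsubC // IHs /=.
by have := mup_XsubCX 1 z x; rewrite expr1 => ->; case: (x == z).
Qed.

(** Over an algebraically closed field [q] splits along some list [r] of roots; multiplicities count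
    occurrences in [r] as well as in [s], so the two lists are permutations of each other. *)
Lemma zeros_with_multE (R : realType) (q : {poly R[i]}) (s : seq R[i]) :
  zeros_with_mult q s -> q = lead_coef q *: \prod_(x <- s) ('X - x%:P).
Proof.
move=> [q0 hs]; have [r hr] := closed_field_poly_normal q.
have lq0 : lead_coef q != 0 by rewrite lead_coef_eq0.
suff rs : perm_eq r s by rewrite {1}hr (perm_big _ rs).
apply/allP => z _ /=.
by rewrite -hs hr -mul_polyC mupMr ?rootC // mup_prod_XsubC.
Qed.

(** Two expressions of the same quadratic are compared through their values at 0, 1 and -1, which
    determine its coefficients. *)
Lemma vieta_deriv_cubic (R : realType) (w1 w2 w3 z1 z2 : R[i]) :
  zeros_with_mult (cubic w1 w2 w3)^`() [:: z1; z2] ->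
  3 * (z1 + z2) = 2 * (w1 + w2 + w3) /\
  3 * (z1 * z2) = w1 * w2 + w2 * w3 + w3 * w1.
Proof.
move=> /zeros_with_multE; set q := _^`(); set c := lead_coef q => hq.
have eqx x : (x - w2) * (x - w3) + (x - w1) * (x - w3) + (x - w1) * (x - w2)
    = c * ((x - z1) * (x - z2)).
  have <- : q.[x] = c * ((x - z1) * (x - z2)).
    by rewrite hq big_cons big_seq1 !hornerE.
  by rewrite /q /cubic !derivM !derivXsubC mul1r !mulr1 !(hornerXsubC, hornerD, hornerM); ring.
have c3 : c = 3.
  have h : 2 * (c - 3) = 0.
    (* The second difference f(1) + f(-1) - 2 f(0) of a quadratic is twice its leading coefficient;
       for the derivative of the cubic it equals 6. *)
    transitivity (c * ((1 - z1) * (1 - z2)) + c * ((-1 - z1) * (-1 - z2))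
      - 2 * (c * ((0 - z1) * (0 - z2))) - 6); first by ring.
    by rewrite -!eqx; ring.
  by apply/eqP; move/eqP: h; rewrite mulf_eq0 pnatr_eq0 subr_eq0.
have e0 := eqx 0; have e1 := eqx 1; rewrite c3 in e0 e1.
have p : 3 * (z1 * z2) = w1 * w2 + w2 * w3 + w3 * w1.
  by transitivity (3 * ((0 - z1) * (0 - z2))); [ring | rewrite -e0; ring].
split=> //.
transitivity (3 + 3 * (z1 * z2) - 3 * ((1 - z1) * (1 - z2))); first by ring.
by rewrite -e1 p; ring.
Qed.

Lemma ratio_eq_iff (F : numFieldType) (a b x y : F) :
  a != 0 -> b != 0 ->
  3 * (x + y) = 2 * (b - a) -> 3 * (x * y) = - (a * b) ->
  (x + a) / a = y / b <-> a ^+ 2 + a * b + b ^+ 2 = 0.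
Proof.
move=> a0 b0 hs hp; split=> [eqr | hab].
- pose u := 3 * (y / b) - 1.
  have ey : 3 * y = b * (u + 1) by rewrite /u; field.
  have ex : 3 * x = a * (u - 2) by rewrite /u -eqr; field.
  have u_root : u ^+ 2 - u + 1 = 0.
    apply: (mulfI (mulf_neq0 a0 b0)); rewrite mulr0.
    transitivity ((3 * x) * (3 * y) + 3 * (a * b)); first by rewrite ex ey; ring.
    by transitivity (3 * (3 * (x * y)) + 3 * (a * b)); [ring | rewrite hp; ring].
  (* The product relation gave the quadratic equation for [u]; the sum relation now links [a] to
     [b]. *)
  have au : a * u = b * (1 - u).
    apply/eqP; rewrite -subr_eq0; apply/eqP.
    transitivity (3 * x + 3 * y - 2 * (b - a)); first by rewrite ex ey; ring.
    by rewrite -hs; ring.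
  have -> : b = a * u ^+ 2.
    transitivity (b * (u ^+ 2 - u + 1) + u * (b * (1 - u))); first by ring.
    by rewrite u_root -au; ring.
  transitivity (a ^+ 2 * (u ^+ 2 + u + 1) * (u ^+ 2 - u + 1)); first by ring.
  by rewrite u_root mulr0.
- have xy : x = y.
    apply/eqP; rewrite -subr_eq0 -sqrf_eq0.
    have n9 : 9 != 0 :> F by rewrite pnatr_eq0.
    rewrite -(mulrI_eq0 _ (mulfI n9)); apply/eqP.
    (* The discriminant (x + y)^2 - 4xy, scaled by 9 so that both Vieta relations apply. *)
    transitivity ((3 * (x + y)) ^+ 2 - 12 * (3 * (x * y))); first by ring.
    rewrite hs hp; transitivity (4 * (a ^+ 2 + a * b + b ^+ 2)); first by ring.
    by rewrite hab mulr0.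
  have {}hs : 3 * y = b - a.
    have n2 : 2 != 0 :> F by rewrite pnatr_eq0.
    by apply: (mulfI n2); rewrite -hs xy; ring.
  apply/eqP; rewrite eqr_div // -subr_eq0 xy.
  have n3 : 3 != 0 :> F by rewrite pnatr_eq0.
  rewrite -(mulrI_eq0 _ (mulfI n3)); apply/eqP.
  (* The cross-multiplied difference, times 3, becomes (b - a)^2 + 3ab once 3y is replaced by b -
     a. *)
  transitivity (3 * y * (b - a) + 3 * (a * b)); first by ring.
  by rewrite hs -[RHS]hab; ring.
Qed.

(** Here [a], [b] and [a + b] are the side vectors of a triangle, the last one up to sign. Forwards,
    the quadratic relation yields b^3 = a^3 and -b^2 = a(a + b), whose norms compare the sides. *)
Lemma equilateral_eq_norm (C : numClosedFieldType) (a b : C) :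
  a != 0 ->
  a ^+ 2 + a * b + b ^+ 2 = 0 <-> `|a| = `|b| /\ `|b| = `|a + b|.
Proof.
move=> a0; split=> [hab | [n1 n2]].
- have cube : b ^+ 3 = a ^+ 3.
    apply/eqP; rewrite -subr_eq0; apply/eqP.
    transitivity ((b - a) * (a ^+ 2 + a * b + b ^+ 2)); first by ring.
    by rewrite hab mulr0.
  have nab : `|a| = `|b|.
    by apply: (pexpIrn (n := 3)); rewrite ?nnegrE // -!normrX cube.
  split=> //; apply: (mulfI (x := `|a|)); first by rewrite normr_eq0.
  rewrite {1}nab -!normrM -(normrN (b * b)); congr `|_|.
  by apply/eqP; rewrite -subr_eq0 -[0]oppr0 -hab; apply/eqP; ring.
- have ea : `|a| ^+ 2 = a * a^* by rewrite normCK.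
  have eb : `|a| ^+ 2 = b * b^* by rewrite n1 normCK.
  have eab : `|a| ^+ 2 = (a + b) * (a^* + b^*) by rewrite n1 n2 normCK rmorphD.
  apply: (mulfI (x := a^*)); first by rewrite conjC_eq0.
  rewrite mulr0.
  (* Multiplying the quadratic form by [a^*] turns it into a combination of differences of squared
     side lengths, all of which vanish. *)
  transitivity (b * ((a + b) * (a^* + b^*) - b * b^*)
    + a * (a * a^* - b * b^*)); first by ring.
  by rewrite -ea -eb -eab; ring.

Qed.

Theorem theorem4 (R : realType) (w1 w2 w3 z1 z2 sigma1 sigma2 : R[i])
  (hw12 : complex.Re w1 < complex.Re w2)
  (hw23 : complex.Re w2 < complex.Re w3)
  (hz : zeros_with_mult (cubic w1 w2 w3)^`() [:: z1; z2])
  (hz12 : z1 = z2 \/ complex.Re z1 < complex.Re z2)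
  (hsigma1 : sigma1 = (z1 - w1) / (w2 - w1))
  (hsigma2 : sigma2 = (z2 - w2) / (w3 - w2)) :
  sigma1 = sigma2 <->
  equilateral_triangle w1 w2 w3 /\ ~ has_vertical_side w1 w2 w3.
Proof.
have neq12 : w1 != w2 by apply: contraTneq hw12 => ->; rewrite ltxx.
have neq23 : w2 != w3 by apply: contraTneq hw23 => ->; rewrite ltxx.
have nvert : ~ has_vertical_side w1 w2 w3.
  case=> -[_ e].
  - by move: hw12; rewrite e ltxx.
  - by move: hw23; rewrite e ltxx.
  - by move: (lt_trans hw12 hw23); rewrite e ltxx.
have a0 : w2 - w1 != 0 by rewrite subr_eq0 eq_sym.
have b0 : w3 - w2 != 0 by rewrite subr_eq0 eq_sym.
have [vs vp] := vieta_deriv_cubic hz.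
(* Vieta's relations are translated so that [w2] becomes the origin. *)
have hs : 3 * ((z1 - w2) + (z2 - w2)) = 2 * ((w3 - w2) - (w2 - w1)).
  by transitivity (3 * (z1 + z2) - 6 * w2); [ring | rewrite vs; ring].
have hp : 3 * ((z1 - w2) * (z2 - w2)) = - ((w2 - w1) * (w3 - w2)).
  transitivity (3 * (z1 * z2) - w2 * (3 * (z1 + z2)) + 3 * w2 ^+ 2); first by ring.
  by rewrite vs vp; ring.
have := ratio_eq_iff a0 b0 hs hp.
have -> : z1 - w2 + (w2 - w1) = z1 - w1 by ring.
rewrite -hsigma1 -hsigma2 => ->.
rewrite (equilateral_eq_norm _ a0).
have -> : w2 - w1 + (w3 - w2) = w3 - w1 by ring.
rewrite /equilateral_triangle (distrC w1).
by split=> [[e1 e2] | [[_ e1 e2] _]].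
Qed.
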